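(* There is a function $\varepsilon:\mathbb{N}\to\mathbb{R}$ with $\varepsilon(d)\to 0$ as $d\to\infty$ such that for every integer $g\ge 3$ and every positive integer $d$ there exists a finite unit distance graph $G$ in $\mathbb{R}^d$ with girth at least $g$ and $\chi(G)\ge (1.074+\varepsilon(d))^d$. (In words: there exist unit distance graphs in $\mathbb{R}^d$ with chromatic number at least $(1.074+o(1))^d$ and arbitrarily large girth, where the $o(1)$ term does not depend on the girth.)
   Context: A graph $G$ is a unit distance graph in $\mathbb{R}^d$ if there is an injective map from $V(G)$ to $\mathbb{R}^d$ such that any two adjacent vertices are mapped to points at Euclidean distance exactly $1$ (non-adjacent vertices may also be at distance $1$; the representation need not be faithful). The girth of a graph is the length of its shortest cycle (infinite if there is no cycle). $\chi(G)$ denotes the chromatic number. *)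

(* Defs.v *)
From Stdlib Require Import Reals.
From mathcomp Require Import all_boot.
Set Implicit Arguments. Unset Strict Implicit. Unset Printing Implicit Defensive.

Record sgraph := SGraph {
  vert : finType;
  adj : rel vert;
  adj_sym : symmetric adj;
  adj_irr : irreflexive adj }.

Definition eucl_dist (d : nat) (x y : 'I_d -> R) : R :=
  sqrt (\big[Rplus/R0]_(i < d) Rmult (Rminus (x i) (y i)) (Rminus (x i) (y i))).

(* G is a unit distance graph in R^d: injective placement, adjacent vertices
   at distance exactly 1 (not necessarily faithful). *)
Definition unit_distance_graph (d : nat) (G : sgraph) : Prop :=
  exists f : vert G -> ('I_d -> R),
    (forall x y, f x = f y -> x = y) /\
    (forall x y, adj x y -> eucl_dist (f x) (f y) = R1).

(* girth at least g: every cycle (a closed walk through >= 3 pairwise distinct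
   vertices) has length at least g; forests have infinite girth. *)
Definition girth_ge (G : sgraph) (g : nat) : Prop :=
  forall s : seq (vert G), ucycle (@adj G) s -> (3 <= size s)%N -> (g <= size s)%N.

Definition colorable (G : sgraph) (k : nat) : bool :=
  [exists c : {ffun vert G -> 'I_k},
     [forall x, forall y, adj x y ==> (c x != c y)]].

Lemma colorable_exists (G : sgraph) : exists k, colorable G k.
Proof.
exists #|vert G|; apply/existsP; exists [ffun x => enum_rank x].
apply/forallP => x; apply/forallP => y; apply/implyP => hxy.
rewrite !ffunE; apply/negP => /eqP /enum_rank_inj exy.
by move: hxy; rewrite exy (adj_irr (s:=G)).
Qed.

Definition chi (G : sgraph) : nat := ex_minn (colorable_exists G).

(* Main.v *)
Require Import Defs.
From Stdlib Require Import Reals.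
From Stdlib Require Lra.
From mathcomp Require Import all_boot all_order all_algebra.
From mathcomp Require Import zify ring lra Rstruct.
Set Implicit Arguments. Unset Strict Implicit. Unset Printing Implicit Defensive.
Import Order.TTheory GRing.Theory Num.Theory.

(** Let [H] be a unit distance graph in [R^d] with [N] vertices and independence
    number at most [al].  Minkowski sums of generically rotated copies of [H]
    realize every Cartesian power [H^t] in the same [R^d].  A set of vertices of
    [H^t] of density at least [2 al / N] spans a fraction of the edges of [H^t]
    that is bounded below independently of [t], while the degree of [H^t] tends
    to infinity.  Hence edges of [H^t] can be chosen greedily, between vertices
    of bounded degree that are far apart in the graph built so far, so that each
    new edge destroys a constant fraction of the dense sets that are still
    independent.  This ends with a graph of girth at least [g] and chromatic number
    greater than [c] as soon as [2 al c <= N], whatever [g] is.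

    For [H] take the [(2q-1)]-subsets of [n] points, [n = d] or [d - 1], joined
    when they meet in [q - 1] points.  For a prime power [q], the Frankl-Wilson
    argument gives [al <= C(n, q-1)].  Using [q = 2^a] with [n/12 < q <= n/6],
    which always exists, no information on the distribution of primes is needed, and
    [N / al] is at least [2^q] or even [3^q] when [q <= n/8]: in both cases more
    than [1.09^n]. *)

(** * Greedy choice of a sparse subgraph *)

(** A list of pairs, since edges are added one at a time and degrees are then counts; the relation
    forgets the orientation. *)
Definition edge_rel (V : finType) (E : seq (V * V)) : rel V :=
  fun x y => ((x, y) \in E) || ((y, x) \in E).

Definition edge_degree (V : finType) (E : seq (V * V)) (x : V) : nat :=
  count (fun p => (p.1 == x) || (p.2 == x)) E.

Fixpoint ball (V : finType) (e : rel V) (k : nat) (x : V) : {set V} :=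
  if k is k'.+1 then x |: \bigcup_(z | e x z) ball e k' z else [set x].

Definition rel_girth_ge (V : finType) (e : rel V) (g : nat) : Prop :=
  forall s : seq V, ucycle e s -> 3 <= size s -> g <= size s.

Lemma edge_rel_sym (V : finType) (E : seq (V * V)) : symmetric (edge_rel E).
Proof. by move=> x y; rewrite /edge_rel orbC. Qed.

Lemma card_neighbours_le (V : finType) (E : seq (V * V)) (x : V) :
  #|[set z | edge_rel E x z]| <= edge_degree E x.
Proof.
pose other (p : V * V) := if p.1 == x then p.2 else p.1.
rewrite /edge_degree -size_filter -(size_map other).
apply: leq_trans (card_size _); apply/subset_leq_card/subsetP => z.
rewrite inE => /orP[] Ez; apply/mapP.
  by exists (x, z); rewrite ?mem_filter /other /= eqxx.
exists (z, x); first by rewrite mem_filter /= eqxx orbT.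
by rewrite /other /=; case: eqP.
Qed.

Lemma sum_edge_degree (V : finType) (E : seq (V * V)) :
  \sum_x edge_degree E x <= 2 * size E.
Proof.
rewrite /edge_degree; elim: E => [|p E IHE]; first by rewrite big1.
rewrite /= big_split /= mulnS leq_add //.
apply: (@leq_trans (\sum_x ((x == p.1) + (x == p.2)))).
  by apply: leq_sum => x _; rewrite ![_ == x]eq_sym; do 2 case: eqP.
by rewrite big_split /= -!big_mkcond !big_pred1_eq.
Qed.

Lemma card_ball_le (V : finType) (e : rel V) (D k : nat) (x : V) :
  (forall y, #|[set z | e y z]| <= D) -> #|ball e k x| <= D.+1 ^ k.
Proof.
move=> degD; elim: k x => [|k IHk] x /=; first by rewrite cards1.
apply: leq_trans (leq_card_setU _ _) _; rewrite cards1 expnS mulSn leq_add //.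
  by rewrite expn_gt0.
apply: (@leq_trans (\sum_(z | e x z) D.+1 ^ k)).
  elim/big_ind2: _ => [|A a B b hA hB|z _]; rewrite ?cards0 //.
  by apply: leq_trans (leq_card_setU _ _) _; rewrite leq_add.
by rewrite sum_nat_const leq_mul2r -(cardsE (e x)) degD orbT.
Qed.

Lemma mem_ball_path (V : finType) (e : rel V) (k : nat) (x : V) (p : seq V) :
  path e x p -> size p <= k -> last x p \in ball e k x.
Proof.
elim: p k x => [|y p IHp] [|k] x //=; rewrite ?inE ?eqxx //.
move=> /andP[exy py] sk; apply/orP; right; apply/bigcupP; exists y => //.
exact: IHp.
Qed.

(* Rotate a cycle so that the new edge closes it: as the vertices are distinct,
   the remaining edges form a path of old edges joining the ends of the new one. *)
Lemma girth_add_edge (V : finType) (E : seq (V * V)) (a b : V) (g : nat) :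
  rel_girth_ge (edge_rel E) g -> b \notin ball (edge_rel E) g a ->
  rel_girth_ge (edge_rel ((a, b) :: E)) g.
Proof.
move=> girthE far s /andP[cyc_s uniq_s] size_s.
set e' := edge_rel _ in cyc_s; set e := edge_rel E in girthE far *.
have old x y : e' x y -> (x, y) != (a, b) -> (y, x) != (a, b) -> e x y.
  by rewrite /e' /e /edge_rel !inE => /orP[] /orP[-> //|->]; rewrite ?orbT.
rewrite leqNgt; apply/negP => short.
suff cyc_old : cycle e s.
  by have := girthE s; rewrite /ucycle cyc_old => /(_ uniq_s size_s); rewrite leqNgt short.
apply: cycle_from_prev => // v vs; set u := prev s v.
have e'uv : e' u v by exact: prev_cycle.
case: (boolP (((u, v) == (a, b)) || ((v, u) == (a, b)))) => [uv|]; last first.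
  by rewrite negb_or => /andP[]; exact: old.
have [i p def_s] := rot_to vs.
have cyc_p : cycle e' (v :: p) by rewrite -def_s rot_cycle.
have uniq_p : uniq (v :: p) by rewrite -def_s rot_uniq.
have size_p : size (v :: p) = size s by rewrite -def_s size_rot.
have last_p : last v p = u.
  have := cycle_prev uniq_p; rewrite -[cycle _ _]/(path _ v (rcons p v)) rcons_path.
  move=> /andP[_ /eqP ->].
  by rewrite -def_s prev_rot.
(* No edge of this path is the new one: the first ends at [w], which differs from [u] as the cycle
   has at least three vertices, and the later ones avoid [v]. *)
have path_p : path e v p.
  move: cyc_p; rewrite /= rcons_path => /andP[+ _].
  case: p last_p uniq_p size_p {def_s} => [|w [|w' p]] //=.
    by move=> _ _ size_s2; rewrite -size_s2 in size_s.
  move=> last_p /and4P[v_notin w_notin w'_notin _] _ /and3P[e'vw e'ww' e'p].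
  have wu : w != u.
    by apply: contraNneq w_notin => ->; rewrite -last_p mem_last.
  have old_off x y : x != v -> y != v -> e' x y -> e x y.
    move=> xv yv e'xy; apply: old => //; apply: contraTneq uv => -[xa yb].
      by rewrite -xa -yb !xpair_eqE ![v == _]eq_sym (negbTE xv) (negbTE yv) ?andbF.
    by rewrite -xa -yb !xpair_eqE ![v == _]eq_sym (negbTE xv) (negbTE yv) ?andbF.
  move: v_notin; rewrite !inE !negb_or ![v == _]eq_sym => /and3P[wv w'v vp].
  apply/and3P; split; [|exact: old_off|].
    apply: old => //; apply: contraTneq uv => -[va wb].
      by rewrite -va -wb !xpair_eqE [v == w]eq_sym [u == w]eq_sym (negbTE wv)
                 (negbTE wu) ?andbF.
    by rewrite -va -wb !xpair_eqE [v == w]eq_sym [u == w]eq_sym (negbTE wv)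
                 (negbTE wu) ?andbF.
  elim: p w' {last_p w_notin w'_notin e'ww'} w'v vp e'p => //= y p IHp x xv.
  rewrite inE negb_or eq_sym => /andP[yv vp] /andP[e'xy e'p].
  by rewrite old_off //= IHp.
have size_p_le : size p <= g by rewrite -size_p in short; rewrite ltnW ?(ltnW short).
(* A path of length at most [g] now joins [a] and [b], against [far]; if it starts at [b] it is
   reversed, as the ball is centred at [a]. *)
case/negP: far; case/orP: uv => /eqP[ua vb].
  rewrite -ua -vb -last_p.
  have rev_p : path e (last v p) (rev (belast v p)).
    by rewrite rev_path (eq_path (e' := e)) // => x y; rewrite /e edge_rel_sym.
  have := mem_ball_path (k := g) rev_p; rewrite size_rev size_belast.
  have -> : last (last v p) (rev (belast v p)) = v.
    by case: (p) => //= w r; rewrite rev_cons last_rcons.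
  exact.
by rewrite -ua -vb -last_p mem_ball_path.
Qed.

Lemma card_fibres_le (V : finType) (P : pred V) (r : rel V) (D : nat) :
  (forall x, #|[set y | r x y]| <= D) ->
  #|[set p : V * V | P p.1 && r p.1 p.2]| <= #|[set x | P x]| * D.
Proof.
move=> degD; rewrite -[X in X <= _]sum1dep_card.
have /= <- := pair_big_dep (op := addn) P r (fun _ _ => 1).
rewrite -sum_nat_const [X in _ <= X](eq_bigl _ _ (in_set _)).
by apply: leq_sum => x _; rewrite sum1dep_card.
Qed.

Lemma card_pairs_le (V : finType) (r : rel V) (D : nat) :
  (forall x, #|[set y | r x y]| <= D) ->
  #|[set p : V * V | r p.1 p.2]| <= #|V| * D.
Proof.
have -> : #|V| = #|[set x : V | predT x]| by rewrite cardsE.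
exact: card_fibres_le.
Qed.

Definition independent_in (V : finType) (e : rel V) (S : {set V}) : bool :=
  [forall x in S, forall y in S, ~~ e x y].

Definition inner_pairs (V : finType) (e : rel V) (S : {set V}) : {set V * V} :=
  [set p | [&& e p.1 p.2, p.1 \in S & p.2 \in S]].

(** Double counting: each member of [F] contains at least [X / Q] of the at most [X] pairs in [A],
    so an average pair lies inside a fraction [1 / Q] of the members. With [F] the surviving sets,
    this selects the next edge. *)
Lemma exists_popular_pair (V : finType) (F : {set {set V}}) (A : {set V * V}) (X Q : nat) :
  0 < #|F| -> 0 < X -> #|A| <= X ->
  (forall S, S \in F -> X <= Q * #|[set p in A | (p.1 \in S) && (p.2 \in S)]|) ->
  exists2 p, p \in A & #|F| <= Q * #|[set S in F | (p.1 \in S) && (p.2 \in S)]|.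
Proof.
move=> F_gt0 X_gt0 AX dense.
case: (boolP [exists p in A, #|F| <= Q * #|[set S in F | (p.1 \in S) && (p.2 \in S)]|]).
  by case/exists_inP => p; exists p.
rewrite negb_exists_in => /forall_inP rare.
have double_count : \sum_(S in F) #|[set p in A | (p.1 \in S) && (p.2 \in S)]| =
    \sum_(p in A) #|[set S in F | (p.1 \in S) && (p.2 \in S)]|.
  under eq_bigr do rewrite -sum1dep_card.
  under [RHS]eq_bigr do rewrite -sum1dep_card.
  rewrite (exchange_big_dep (mem A)) /= => [|S p _ /andP[] //].
  by apply: eq_bigr => p pA; apply: eq_bigl => S; rewrite (pA : p \in A).
have lower : #|F| * X <= Q * \sum_(S in F) #|[set p in A | (p.1 \in S) && (p.2 \in S)]|.
  by rewrite big_distrr /= -sum_nat_const leq_sum.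
have upper : Q * \sum_(p in A) #|[set S in F | (p.1 \in S) && (p.2 \in S)]|
    <= #|A| * #|F|.-1.
  rewrite big_distrr /= -sum_nat_const; apply: leq_sum => p /rare.
  by rewrite -ltnNge; case: #|F| F_gt0.
have := leq_trans lower; rewrite double_count => /(_ _ upper) contra.
have : #|A| * #|F|.-1 <= X * #|F|.-1 by rewrite leq_mul2r AX orbT.
move: contra; case: #|F| F_gt0 => // n _ /=; nia.
Qed.

(** Pairs that may become edges: degrees stay at most [Delta], which keeps balls small, and distant
    ends preserve the girth. *)
Definition admissible_pairs (V : finType) (e : rel V) (E : seq (V * V)) (Delta g : nat) :
    {set V * V} :=
  [set p | [&& e p.1 p.2, edge_degree E p.1 < Delta, edge_degree E p.2 < Delta
             & p.2 \notin ball (edge_rel E) g p.1]].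

Lemma card_saturated_le (V : finType) (E : seq (V * V)) (Delta : nat) :
  #|[set x | Delta <= edge_degree E x]| * Delta <= 2 * size E.
Proof.
apply: leq_trans (sum_edge_degree E).
rewrite -sum_nat_const (eq_bigl _ _ (in_set _)).
rewrite [X in _ <= X](bigID (fun x => Delta <= edge_degree E x)) /=.
by apply: leq_trans (leq_addr _ _); apply: leq_sum.
Qed.

(** A pair inside [S] that is not admissible has a saturated end or joins two vertices at distance
    at most [g]; the last two terms count these two kinds. *)
Lemma card_inner_pairs_le (V : finType) (e : rel V) (E : seq (V * V)) (D Delta g : nat)
    (S : {set V}) :
  symmetric e -> (forall x, #|[set y | e x y]| <= D) ->
  (forall x, edge_degree E x <= Delta) ->
  #|inner_pairs e S| <=
    #|[set p in admissible_pairs e E Delta g | (p.1 \in S) && (p.2 \in S)]|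
    + 2 * (#|[set x | Delta <= edge_degree E x]| * D) + #|V| * Delta.+1 ^ g.
Proof.
move=> e_sym degD degE.
pose sat x := Delta <= edge_degree E x.
pose A1 := [set p : V * V | sat p.1 && e p.1 p.2].
pose A2 := [set p : V * V | sat p.2 && e p.2 p.1].
pose A3 := [set p : V * V | p.2 \in ball (edge_rel E) g p.1].
have card1 : #|A1| <= #|[set x | sat x]| * D by exact: card_fibres_le.
have card2 : #|A2| <= #|[set x | sat x]| * D.
  suff -> : #|A2| = #|A1| by [].
  pose sw (p : V * V) := (p.2, p.1).
  have sw_inj : injective sw by move=> [a b] [c d] [-> ->].
  rewrite -(card_imset A1 sw_inj); apply: eq_card => -[a b].
  apply/idP/imsetP => [|[[c d]]]; rewrite !inE /=.
    by move=> h; exists (b, a); rewrite ?inE.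
  by move=> h [-> ->].
have card3 : #|A3| <= #|V| * Delta.+1 ^ g.
  apply: (@card_pairs_le V (fun x y => y \in ball (edge_rel E) g x)) => x.
  rewrite (eq_card (in_set _)); apply: card_ball_le => y.
  exact: leq_trans (card_neighbours_le _ _) (degE y).
set A0 := [set p in _ | _].
have : inner_pairs e S \subset A0 :|: (A1 :|: A2) :|: A3.
  apply/subsetP => -[a b]; rewrite !inE /= => /and3P[eab -> ->]; rewrite andbT.
  rewrite [e b a]e_sym eab /sat !andbT /= 2!ltnNge.
  by case: (Delta <= _) => //=; case: (Delta <= _) => //=; rewrite !orbF orNb.
move/subset_leq_card => h; apply: leq_trans h _.
apply: leq_trans (leq_card_setU _ _) _; rewrite leq_add //.
apply: leq_trans (leq_card_setU _ _) _; rewrite leq_add2l //.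
apply: leq_trans (leq_card_setU _ _) _; rewrite mul2n -addnn leq_add //.
Qed.

Definition surviving (V : finType) (E : seq (V * V)) (big : {set {set V}}) : {set {set V}} :=
  [set S in big | independent_in (edge_rel E) S].

(** The old survivors containing both ends of [p] are killed by it, so they and the new survivors
    are disjoint families of old survivors. *)
Lemma surviving_add_edge (V : finType) (E : seq (V * V)) (big : {set {set V}}) (p : V * V) :
  #|surviving (p :: E) big| + #|[set S in surviving E big | (p.1 \in S) && (p.2 \in S)]|
    <= #|surviving E big|.
Proof.
set K := [set S in _ | _].
have disj : [disjoint surviving (p :: E) big & K].
  apply/pred0P => S /=; apply/negP => /andP[]; rewrite !inE.
  case/andP=> _ /forall_inP ind /andP[_ /andP[p1S p2S]].
  by have /forall_inP/(_ _ p2S) := ind _ p1S; rewrite /edge_rel inE -surjective_pairing eqxx.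
have <- : #|surviving (p :: E) big :|: K| = #|surviving (p :: E) big| + #|K|.
  by rewrite cardsU (disjoint_setI0 disj) cards0 subn0.
apply/subset_leq_card/subsetP => S; rewrite !inE => /orP[|/andP[] //].
case/andP=> -> /forall_inP ind; apply/forall_inP => x xS; apply/forall_inP => y yS.
have /forall_inP/(_ _ yS) := ind _ xS; apply: contra.
by rewrite /edge_rel !inE => /orP[] ->; rewrite !orbT.
Qed.

(** With [Q = n + 1], Bernoulli's inequality gives [(1 + 1 / n) ^ (3 * Q) >= 1 + 3 * Q / n >= 4]. *)
Lemma four_expn_pred (Q : nat) : 0 < Q -> 4 * Q.-1 ^ (3 * Q) <= Q ^ (3 * Q).
Proof.
case: Q => // n _ /=.
have bernoulli m : n ^ m * (n + m) <= n.+1 ^ m * n.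
  elim: m => [|m IHm]; first by rewrite !expn0 addn0.
  rewrite !expnS; move: (n ^ m) (n.+1 ^ m) IHm => a b; nia.
have := bernoulli (3 * n.+1); case: (posnP n) => [->|n_gt0].
  by rewrite exp0n.
move: (n ^ _) (n.+1 ^ _) => a b; nia.
Qed.

(* With [Q = 2 K], each of the [3 Q |V|] greedy steps keeps at most a fraction
   [1 - 1 / Q] of the surviving sets, and [(1 - 1 / Q) ^ (3 Q) <= 1 / 4] beats the
   [2 ^ |V|] initial sets.  The degree cap [96 K ^ 2] leaves at most [|V| / (8 K)]
   saturated vertices; they and the short distances exclude at most half of the
   pairs inside a set of [big]. *)
Lemma sparse_subgraph (V : finType) (e : rel V) (big : {set {set V}}) (D K g : nat) :
  symmetric e -> 0 < K -> 0 < #|V| ->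
  (forall x, #|[set y | e x y]| <= D) ->
  (forall S, S \in big -> #|V| * D <= K * #|inner_pairs e S|) ->
  4 * K * (96 * K ^ 2).+1 ^ g <= D ->
  exists e' : rel V, [/\ symmetric e', subrel e' e, rel_girth_ge e' g
    & forall S, S \in big -> ~~ independent_in e' S].
Proof.
move=> e_sym K_gt0 V_gt0 degD dense largeD.
set Delta := 96 * K ^ 2 in largeD; set M := #|V| in V_gt0 dense; set Q := 2 * K.
have D_gt0 : 0 < D.
  by apply: leq_trans largeD; rewrite !muln_gt0 K_gt0 expn_gt0.
have [E [_ Ee _ girthE survE]] : exists E : seq (V * V),
    [/\ size E <= 3 * Q * M, all (fun p => e p.1 p.2) E,
        forall x, edge_degree E x <= Delta, rel_girth_ge (edge_rel E) g
      & #|surviving E big| * Q ^ (3 * Q * M) <= 2 ^ M * Q.-1 ^ (3 * Q * M)].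
  (* Induction on the number [i] of steps done; the bound [i <= 3 * Q * M] is kept to limit the
     saturated vertices. *)
  move: (leqnn (3 * Q * M)); move: {1 3 4 5}(3 * Q * M) => i.
  elim: i => [_|i IHi lti].
    exists [::]; split => //; last first.
      rewrite !expn0 !muln1 /M -cardsT -card_powerset; 
      by apply/subset_leq_card/subsetP => S; rewrite !inE subsetT.
    by move=> [|x [|y s]].
  have [E [sizeE Ee degE girthE survE]] := IHi (ltnW lti).
  case: (posnP #|surviving E big|) => [surv0|surv_gt0].
    by exists E; split => //; [exact: leqW | rewrite surv0].
  have [||S survS|p] := @exists_popular_pair V (surviving E big)
      (admissible_pairs e E Delta g) (M * D) Q surv_gt0.
  - by rewrite muln_gt0 V_gt0.
  - apply: leq_trans (card_pairs_le degD); apply/subset_leq_card/subsetP => p.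
    by rewrite !inE => /and4P[].
  - have bigS : S \in big by move: survS; rewrite inE => /andP[].
    have := dense _ bigS; have := card_inner_pairs_le g S e_sym degD degE.
    have := card_saturated_le E Delta; rewrite -/M.
    move: (#|inner_pairs e S|) (#|[set x | _]|) (#|[set p in _ | _]|) => a F b.
    move: largeD; move: (Delta.+1 ^ g) => B largeD satF ab MDa.
    (* Summing degrees, [96 * K ^ 2 * F <= 12 * K * M]. Then [2 * K * F * D] and [K * M * B] are
       each at most [M * D / 4], which leaves [2 * K * b >= M * D]. *)
    have KF : 8 * K * F <= M.
      have : 12 * K * (8 * K * F) <= 12 * K * M.
        by move: satF; rewrite /Delta /Q in lti *; nia.
      by rewrite leq_pmul2l // muln_gt0.
    have FD : 8 * K * F * D <= M * D by rewrite leq_mul2r KF orbT.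
    have MB : M * (4 * K * B) <= M * D by rewrite leq_mul2l largeD orbT.
    have : K * a <= K * (b + 2 * (F * D) + M * B) by rewrite leq_mul2l ab orbT.
    rewrite /Q; nia.
  rewrite inE => /and4P[ep deg1 deg2 far] popular.
  exists (p :: E); split => //=.
  - by rewrite ep.
  - move=> x; rewrite /edge_degree /= -/(edge_degree E x).
    have := degE x; case: eqP => [<- _|_]; first exact: deg1.
    by case: eqP => [<- _|_] //; exact: deg2.
  - by move: far; rewrite [p]surjective_pairing; exact: girth_add_edge.
  have step : Q * #|surviving (p :: E) big| <= Q.-1 * #|surviving E big|.
    have := surviving_add_edge E big p; move: popular.
    move: (#|[set S in _ | _]|) (#|surviving E big|) (#|surviving (p :: E) big|) => a b c.
    have : 0 < Q by rewrite muln_gt0.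
    case: (Q) => // q _; nia.
  rewrite !expnS [X in X <= _]mulnCA [X in X <= _]mulnA [X in _ <= X]mulnCA.
  apply: (@leq_trans (Q.-1 * #|surviving E big| * Q ^ i)).
    by rewrite leq_mul2r step orbT.
  by rewrite -mulnA leq_mul2l survE orbT.
exists (edge_rel E); split=> //; first exact: edge_rel_sym.
  move=> x y /orP[] /(allP Ee) //=; first by rewrite e_sym.
(* Such an [S] would be a survivor, so [Q ^ (3 * Q * M) <= 2 ^ M * Q.-1 ^ (3 * Q * M)], against the
   [M]-th power of [four_expn_pred]. *)
move=> S bigS; apply/negP => indS.
have Q_gt0 : 0 < Q by rewrite muln_gt0.
have surv_gt0 : 0 < #|surviving E big|.
  by apply/card_gt0P; exists S; rewrite inE bigS.
have : 4 ^ M * Q.-1 ^ (3 * Q * M) <= Q ^ (3 * Q * M).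
  by rewrite !(expnM _ (3 * Q)) -expnMn leq_exp2r ?four_expn_pred.
have Qpow : 0 < Q ^ (3 * Q * M) by rewrite expn_gt0 Q_gt0.
have : 2 ^ M < 4 ^ M by rewrite ltn_exp2r.
move: survE Qpow; move: (Q ^ _) (Q.-1 ^ _) (2 ^ M) (4 ^ M) => a b c d.
case: (posnP b) => [->|]; first by rewrite muln0; nia.
nia.
Qed.

(** * Cartesian powers *)

Definition set_at (U : finType) (t : nat) (x : {ffun 'I_t -> U}) (j : 'I_t) (u : U) :
    {ffun 'I_t -> U} :=
  [ffun i => if i == j then u else x i].

Definition power_rel (U : finType) (h : rel U) (t : nat) : rel {ffun 'I_t -> U} :=
  fun x y => [exists j, h (x j) (y j) && (y == set_at x j (y j))].

Lemma set_at_at (U : finType) (t : nat) (x : {ffun 'I_t -> U}) j u : set_at x j u j = u.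
Proof. by rewrite ffunE eqxx. Qed.

Lemma set_at_set_at (U : finType) (t : nat) (x : {ffun 'I_t -> U}) j u v :
  set_at (set_at x j u) j v = set_at x j v.
Proof. by apply/ffunP => i; rewrite !ffunE; case: eqP. Qed.

Lemma set_at_id (U : finType) (t : nat) (x : {ffun 'I_t -> U}) j : set_at x j (x j) = x.
Proof. by apply/ffunP => i; rewrite !ffunE; case: eqP => [->|]. Qed.

Lemma power_rel_sym (U : finType) (h : rel U) (t : nat) :
  symmetric h -> symmetric (@power_rel U h t).
Proof.
move=> h_sym x y; apply/existsP/existsP => -[j /andP[hj /eqP def]]; exists j.
  by rewrite h_sym hj /= def set_at_set_at set_at_id.
by rewrite h_sym hj /= def set_at_set_at set_at_id.
Qed.

Lemma power_rel_degree (U : finType) (h : rel U) (t : nat) (x : {ffun 'I_t -> U}) :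
  #|[set y | power_rel h x y]| <= t * #|U|.
Proof.
rewrite -[t in t * _]card_ord -card_prod.
apply: leq_trans (leq_imset_card (fun p => set_at x p.1 p.2) predT).
apply/subset_leq_card/subsetP => y; rewrite inE => /existsP[j /andP[_ /eqP def]].
by apply/imsetP; exists (j, y j).
Qed.

(** Each line in direction [j] is a copy of [U] meeting [T] in an independent set, hence in at most
    [al] points. Averaging over lines, each counted once per point, bounds the density of [T]. *)
Lemma line_independent_card (U : finType) (h : rel U) (al t : nat) (j : 'I_t)
    (T : {set {ffun 'I_t -> U}}) :
  (forall A : {set U}, independent_in h A -> #|A| <= al) ->
  (forall y v, y \in T -> set_at y j v \in T -> ~~ h (y j) v) ->
  #|U| * #|T| <= al * #|{ffun 'I_t -> U}|.
Proof.
move=> indep_al indT.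
pose B := [set p : {ffun 'I_t -> U} * U | set_at p.1 j p.2 \in T].
have upper : #|B| <= #|{ffun 'I_t -> U}| * al.
  rewrite -sum1dep_card.
  have /= <- := pair_big_dep (op := addn) predT
    (fun (x : {ffun 'I_t -> U}) u => set_at x j u \in T) (fun _ _ => 1).
  rewrite -sum_nat_const; apply: leq_sum => x _; rewrite sum1dep_card.
  apply: indep_al; apply/forall_inP => u; rewrite inE => uT.
  apply/forall_inP => v; rewrite inE => vT.
  have := indT _ v uT; rewrite set_at_at set_at_set_at; exact.
apply: (@leq_trans #|B|); last by rewrite mulnC.
pose f (p : {ffun 'I_t -> U} * U) := (set_at p.1 j p.2, p.1 j).
have f_inj : injective f.
  move=> [x u] [y v] [exy ej]; congr (_, _).
    by rewrite -(set_at_id x j) -(set_at_id y j) -(set_at_set_at x j u) exy ej set_at_set_at.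
  by rewrite -(set_at_at x j u) exy set_at_at.
rewrite mulnC -[#|U|]cardsT -cardsX -(card_imset (setX T setT) f_inj).
apply/subset_leq_card/subsetP => p /imsetP[[x u]]; rewrite inE => /andP[xT _] ->.
by rewrite inE /= set_at_set_at set_at_id.
Qed.

(** For each direction [j], the points of [S] without a neighbour in [S] along [j] have density at
    most [al / #|U|] by [line_independent_card], half of what [S] is assumed to have. The others, of
    density at least [1 / #|U|], each give a pair; sum over the [t] directions. *)
Lemma power_rel_dense (U : finType) (h : rel U) (al t : nat) (S : {set {ffun 'I_t -> U}}) :
  irreflexive h -> 0 < al ->
  (forall A : {set U}, independent_in h A -> #|A| <= al) ->
  2 * al * #|{ffun 'I_t -> U}| <= #|U| * #|S| ->
  t * #|{ffun 'I_t -> U}| <= #|U| * #|inner_pairs (@power_rel U h t) S|.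
Proof.
move=> h_irr al_gt0 indep_al bigS; set M := #|{ffun _}|.
pose P (y : {ffun 'I_t -> U}) j v := h (y j) v && (set_at y j v \in S).
pose A j := [set y in S | [exists v, P y j v]].
have cardA j : M <= #|U| * #|A j|.
  have : #|U| * #|S :\: A j| <= al * M.
    apply: (line_independent_card (j := j) indep_al) => y v.
    rewrite !inE negb_and => /andP[+ yS] /andP[_ vS]; rewrite yS /= => /existsPn/(_ v).
    by rewrite /P vS andbT.
  have : #|S :\: A j| + #|A j| = #|S|.
    rewrite addnC -[RHS](cardsID (A j) S) (setIidPr _) //.
    by apply/subsetP => y; rewrite inE => /andP[].
  by move: bigS; rewrite -/M; nia.
pose f (p : 'I_t * {ffun 'I_t -> U}) :=
  (p.2, set_at p.2 p.1 (odflt (p.2 p.1) [pick v | P p.2 p.1 v])).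
pose B := [set p : 'I_t * {ffun 'I_t -> U} | p.2 \in A p.1].
have pickP p : p \in B -> exists2 v, P p.2 p.1 v & f p = (p.2, set_at p.2 p.1 v).
  rewrite !inE => /andP[_ /existsP[v Pv]]; rewrite /f.
  by case: pickP => [w Pw|/(_ v)]; [exists w | rewrite Pv].
(* The pair determines its direction: the only coordinate where its ends differ, by irreflexivity of
   [h]. *)
have f_inj : {in B &, injective f}.
  move=> p q /pickP[v /andP[hv _] fp] /pickP[w /andP[hw _] fq]; rewrite fp fq.
  case: p q hv hw {fp fq} => [i x] [j y] /= hv hw [exy]; rewrite -exy in hw * => /ffunP/(_ i).
  rewrite !ffunE eqxx; case: eqP => [->|_ vx] //.
  by rewrite vx h_irr in hv.
have cardB : t * M <= #|U| * #|B|.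
  rewrite -sum1dep_card.
  have /= <- := pair_big_dep (op := addn) predT (fun j y => y \in A j) (fun _ _ => 1).
  rewrite big_distrr /= -[t in t * _]card_ord -sum_nat_const; apply: leq_sum => j _.
  by rewrite sum1_card.
apply: leq_trans cardB _; rewrite leq_mul2l -(card_in_imset f_inj); apply/orP; right.
apply/subset_leq_card/subsetP => _ /imsetP[p pB ->].
have [v /andP[hv vS] ->] := pickP p pB; move: pB; rewrite !inE => /andP[-> _] /=.
by rewrite vS !andbT; apply/existsP; exists p.1; rewrite set_at_at hv eqxx.
Qed.

(** Some colour class has density at least [1 / c], hence at least [2 * al / #|U|]; the sparse
    subgraph is built so that no such set is independent. *)
Lemma high_girth_power (U : finType) (h : rel U) (al c g : nat) :
  symmetric h -> irreflexive h -> 0 < al -> 0 < #|U| ->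
  (forall A : {set U}, independent_in h A -> #|A| <= al) ->
  2 * al * c <= #|U| ->
  exists t (e : rel {ffun 'I_t -> U}),
    [/\ symmetric e, subrel e (@power_rel U h t), rel_girth_ge e g
      & forall col : {ffun 'I_t -> U} -> 'I_c, exists x y, e x y && (col x == col y)].
Proof.
move=> h_sym h_irr al_gt0 U_gt0 indep_al alc; set N := #|U| in U_gt0 alc.
(* The value that [sparse_subgraph] demands of the degree bound [t * N] when [K = N ^ 2]; one factor
   [N] of [K] comes from [power_rel_dense], the other from the degree bound. *)
pose t := 4 * N ^ 2 * (96 * (N ^ 2) ^ 2).+1 ^ g; exists t.
pose V := {ffun 'I_t -> U} : finType.
have V_gt0 : 0 < #|V| by rewrite card_ffun expn_gt0 U_gt0.
pose big := [set S : {set V} | 2 * al * #|V| <= N * #|S|].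
have [|S||e [e_sym eh girth_e no_indep]] :=
  @sparse_subgraph V (@power_rel U h t) big (t * N) (N ^ 2) g
    (power_rel_sym h_sym) _ V_gt0 (@power_rel_degree U h t).
- by rewrite expn_gt0 U_gt0.
- rewrite inE => /(power_rel_dense h_irr al_gt0 indep_al) dense.
  rewrite mulnA [X in X <= _]mulnC [#|V| * t]mulnC expnS expn1 -mulnA.
  by rewrite leq_mul2l dense orbT.
- by rewrite -/t leq_pmulr.
exists e; split=> // col.
have [k large] : exists k, #|V| <= c * #|[set x | col x == k]|.
  apply/existsP; apply: contraT; rewrite negb_exists => /forallP small.
  have : c * #|V| = \sum_(k : 'I_c) c * #|[set x | col x == k]|.
    rewrite -big_distrr /= -sum1_card; congr (_ * _).
    rewrite (partition_big col predT) //=; apply: eq_bigr => k _.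
    by rewrite sum1dep_card.
  have : \sum_(k : 'I_c) (c * #|[set x | col x == k]|).+1 <= \sum_(k : 'I_c) #|V|.
    by apply: leq_sum => k _; have := small k; rewrite -ltnNge.
  rewrite sum_nat_const card_ord => lt_sum eq_sum.
  have /card_gt0P[x _] := V_gt0; have c_gt0 := leq_ltn_trans (leq0n _) (ltn_ord (col x)).
  move: lt_sum; under eq_bigr do rewrite -addn1.
  by rewrite big_split /= -eq_sum sum_nat_const card_ord muln1
    -[X in _ <= X]addn0 leq_add2l leqNgt c_gt0.
have : [set x | col x == k] \in big.
  rewrite inE; apply: (@leq_trans (2 * al * (c * #|[set x | col x == k]|))).
    by rewrite leq_mul2l large orbT.
  by rewrite mulnA leq_mul2r alc orbT.
move/no_indep; rewrite negb_forall_in => /exists_inP[x]; rewrite inE => /eqP colx.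
rewrite negb_forall_in => /exists_inP[y]; rewrite inE negbK => /eqP coly exy.
by exists x, y; rewrite exy colx coly eqxx.
Qed.

(** * Rotated copies *)

Section Geometry.
Local Open Scope ring_scope.

Definition sqdist (R : realFieldType) (I : finType) (x y : I -> R) : R :=
  \sum_i (x i - y i) ^+ 2.

(* Multiplication by the complex number [z.1 + i z.2] on [R^(J * bool) = C^J]. *)
Definition rotate (R : realFieldType) (J : finType) (z : R * R) (x : J * bool -> R) :
    J * bool -> R :=
  fun p => if p.2 then z.2 * x (p.1, false) + z.1 * x (p.1, true)
           else z.1 * x (p.1, false) - z.2 * x (p.1, true).

Lemma sqdist_rotate (R : realFieldType) (J : finType) (z : R * R) (x y : J * bool -> R) :
  z.1 ^+ 2 + z.2 ^+ 2 = 1 -> sqdist (rotate z x) (rotate z y) = sqdist x y.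
Proof.
case: z => c s /= norm1; rewrite /sqdist.
have split_sum (F : J * bool -> R) : \sum_p F p = \sum_j (F (j, true) + F (j, false)).
  transitivity (\sum_p F (p.1, p.2)); first by apply: eq_bigr => -[].
  rewrite -(pair_bigA _ (fun j b => F (j, b))).
  by apply: eq_bigr => j _; rewrite big_bool.
rewrite !split_sum; apply: eq_bigr => j _; rewrite /rotate /=.
rewrite -[RHS]mul1r -norm1; ring.
Qed.

(** In complex terms [(z - w) * x = 0] with [z - w] nonzero; multiply by its conjugate. *)
Lemma rotate_inj (R : realFieldType) (J : finType) (z w : R * R) (x : J * bool -> R) :
  z != w -> rotate z x =1 rotate w x -> x =1 (fun=> 0).
Proof.
move=> zw eq_rot [j b]; pose a := x (j, false); pose a' := x (j, true).
have := eq_rot (j, false); have := eq_rot (j, true); rewrite /rotate /= -/a -/a'.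
pose dc := z.1 - w.1; pose ds := z.2 - w.2 => eq1 eq0.
have e1 : ds * a + dc * a' = 0 by rewrite /ds /dc; lra.
have e0 : dc * a - ds * a' = 0 by rewrite /ds /dc; lra.
have norm_neq0 : dc ^+ 2 + ds ^+ 2 != 0.
  rewrite paddr_eq0 ?sqr_ge0 // !sqrf_eq0 !subr_eq0.
  apply: contra zw => /andP[/eqP z1 /eqP z2].
  by rewrite [z]surjective_pairing z1 z2 -surjective_pairing.
have a0 : a = 0.
  apply: (mulfI norm_neq0); rewrite mulr0.
  transitivity (dc * (dc * a - ds * a') + ds * (ds * a + dc * a')); first ring.
  by rewrite e0 e1 !mulr0 addr0.
have a'0 : a' = 0.
  apply: (mulfI norm_neq0); rewrite mulr0.
  transitivity (dc * (ds * a + dc * a') - ds * (dc * a - ds * a')); first ring.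
  by rewrite e0 e1 !mulr0 subr0.
by case: b.
Qed.

(** Rational parametrization of the unit circle, an infinite supply of rotations. *)
Definition circle_point (R : realFieldType) (n : nat) : R * R :=
  ((1 - n%:R ^+ 2) / (1 + n%:R ^+ 2), (2 * n%:R) / (1 + n%:R ^+ 2)).

Lemma one_add_sqr_natr_neq0 (R : realFieldType) (n : nat) : 1 + n%:R ^+ 2 != 0 :> R.
Proof. by rewrite gt_eqF // ltr_pwDl // sqr_ge0. Qed.

Lemma circle_point_norm (R : realFieldType) (n : nat) :
  (circle_point R n).1 ^+ 2 + (circle_point R n).2 ^+ 2 = 1.
Proof. by rewrite /circle_point /=; field; exact: one_add_sqr_natr_neq0. Qed.

Lemma circle_point_inj (R : realFieldType) : injective (circle_point R).
Proof.
move=> m n [eq1 _].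
have m0 := one_add_sqr_natr_neq0 R m; have n0 := one_add_sqr_natr_neq0 R n.
have : (m%:R : R) ^+ 2 = n%:R ^+ 2.
  move/eqP: eq1; rewrite eqr_div // => /eqP; lra.
move/eqP; by rewrite eqrXn2 ?ler0n // eqr_nat => /eqP.
Qed.

Definition placement (R : realFieldType) (J U : finType) (f : U -> J * bool -> R)
    (z : nat -> R * R) (t : nat) (x : {ffun 'I_t -> U}) : J * bool -> R :=
  fun p => \sum_(j < t) rotate (z j) (f (x j)) p.

(** Adjacent tuples differ in one coordinate, so the other summands cancel and a rotated edge of a
    single copy remains. *)
Lemma sqdist_placement (R : realFieldType) (J U : finType) (f : U -> J * bool -> R)
    (z : nat -> R * R) (h : rel U) (t : nat) (x y : {ffun 'I_t -> U}) :
  (forall j, (z j).1 ^+ 2 + (z j).2 ^+ 2 = 1) ->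
  (forall u v, h u v -> sqdist (f u) (f v) = 1) ->
  power_rel h x y -> sqdist (placement f z x) (placement f z y) = 1.
Proof.
move=> normz f_unit /existsP[j /andP[hj /eqP def]].
rewrite -(f_unit _ _ hj) -[RHS](sqdist_rotate _ _ (normz j)); apply: eq_bigr => p _.
have split_sum w : placement f z w p =
    rotate (z j) (f (w j)) p + \sum_(i < t | i != j) rotate (z i) (f (w i)) p.
  by rewrite /placement (bigD1 j).
congr (_ ^+ 2); rewrite !split_sum opprD addrACA -[RHS]addr0; congr (_ + _).
apply/eqP; rewrite subr_eq0; apply/eqP.
by apply: eq_bigr => i ij; rewrite def ffunE (negbTE ij).
Qed.

(* If every circle point were bad for the last coordinate, two of them would be
   bad for the same pair of tuples, contradicting [rotate_inj]. *)
Lemma exists_injective_placement (R : realFieldType) (J U : finType)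
    (f : U -> J * bool -> R) (t : nat) :
  (forall u v, f u =1 f v -> u = v) ->
  exists2 z : nat -> R * R, forall j, (z j).1 ^+ 2 + (z j).2 ^+ 2 = 1
    & forall x y : {ffun 'I_t -> U}, placement f z x =1 placement f z y -> x = y.
Proof.
move=> f_inj; elim: t => [|t [z normz z_inj]].
  exists (fun=> circle_point R 0) => [j|x y _]; first exact: circle_point_norm.
  by apply/ffunP => -[].
pose z' k j := if (j < t)%N then z j else circle_point R k.
have normz' k j : (z' k j).1 ^+ 2 + (z' k j).2 ^+ 2 = 1.
  by rewrite /z'; case: ifP => _; [exact: normz | exact: circle_point_norm].
pose W := {ffun 'I_t.+1 -> U}.
pose low (x : W) : {ffun 'I_t -> U} := [ffun i => x (widen_ord (leqnSn t) i)].
have split_place k (x : W) p :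
    placement f (z' k) x p =
    placement f z (low x) p + rotate (circle_point R k) (f (x ord_max)) p.
  rewrite /placement big_ord_recr /= {2}/z' ltnn; congr (_ + _).
  by apply: eq_bigr => i _; rewrite /z' /= ltn_ord ffunE.
pose bad k (q : W * W) := (q.1 != q.2) &&
  [forall p, placement f (z' k) q.1 p == placement f (z' k) q.2 p].
case: (boolP [forall k : 'I_(#|{: W * W}|).+1, exists q, bad k q]); last first.
  rewrite negb_forall => /existsP[k]; rewrite negb_exists => /forallP good.
  exists (z' k) => // x y eq_place; apply/eqP; apply: contraT => xy.
  have := good (x, y); rewrite /bad /= xy /= => /negP[].
  by apply/forallP => p; rewrite eq_place.
move=> /forallP all_bad.
have [q badq] : exists q : 'I_(#|{: W * W}|).+1 -> W * W,
    forall k : 'I__, bad k (q k).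
  by apply: (fin_all_exists (P := fun k q => bad (nat_of_ord k) q)) => k; apply/existsP.
suff q_inj : injective q by have := leq_card q q_inj; rewrite card_ord ltnn.
move=> k k' eqq; have /andP[xy /forallP bad1] := badq k.
have /andP[_ /forallP bad2] := badq k'; rewrite -eqq in bad2.
move: (q k) xy bad1 bad2 {eqq} => [x y] /= xy bad1 bad2.
apply/eqP; apply: contraNT xy => kk'.
(* Subtracting the two coincidences removes the first [t] summands, so both rotations agree on the
   difference [b] of the last points. *)
have last_eq : x ord_max = y ord_max.
  apply: f_inj => p; apply/eqP; rewrite -subr_eq0.
  pose b p := f (x ord_max) p - f (y ord_max) p.
  have zk : circle_point R k != circle_point R k'.
    by apply: contra kk' => /eqP/circle_point_inj/val_inj ->.
  apply/eqP; apply: (rotate_inj (x := b) zk) => r.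
  have lin w : rotate w b r = rotate w (f (x ord_max)) r - rotate w (f (y ord_max)) r.
    by rewrite /rotate /b; case: ifP => _; ring.
  rewrite !lin; have /eqP := bad1 r; have /eqP := bad2 r; rewrite !split_place.
  move: (rotate _ _ _) (rotate _ _ _) (placement _ _ _ _) (placement _ _ _ _).
  by move: (rotate _ _ _) (rotate _ _ _) => a1 a2 a3 a4 a5 a6; lra.
have /ffunP low_eq : low x = low y.
  apply: z_inj => p; have /eqP := bad1 p; rewrite !split_place last_eq.
  exact: addIr.
apply/eqP/ffunP => i; case: (ltnP i t) => it.
  have := low_eq (Ordinal it); rewrite !ffunE.
  by have -> : widen_ord (leqnSn t) (Ordinal it) = i by exact: val_inj.
have -> : i = ord_max by apply/val_inj/eqP; rewrite /= eqn_leq it -ltnS ltn_ord.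
by [].
Qed.

(** Coordinates in enumeration order, then zeros: an isometric embedding into dimension [d] once
    [#|I| <= d]. *)
Definition extend0 (R : realFieldType) (I : finType) (x : I -> R) (i : nat) : R :=
  if insub i is Some k then x (@enum_val I I k) else 0.

Lemma sqdist_extend0 (R : realFieldType) (I : finType) (d : nat) (x y : I -> R) :
  (#|I| <= d)%N -> \sum_(i < d) (extend0 x i - extend0 y i) ^+ 2 = sqdist x y.
Proof.
move=> Id; have /= widen := big_ord_widen d (fun i => (extend0 x i - extend0 y i) ^+ 2) Id.
rewrite (bigID (fun i : 'I_d => (i < #|I|)%N)) /= -widen [X in _ + X]big1 => [|i]; last first.
  by rewrite /extend0; case: insubP => [k -> //|_ _]; rewrite subr0 expr0n.
rewrite addr0 /sqdist [RHS](big_enum_val (A := I) (fun i => (x i - y i) ^+ 2)).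
by apply: eq_bigr => i _; rewrite /extend0 valK.
Qed.

Lemma extend0_inj (R : realFieldType) (I : finType) (d : nat) (x y : I -> R) :
  (#|I| <= d)%N -> (forall i : 'I_d, extend0 x i = extend0 y i) -> x =1 y.
Proof.
move=> Id eq_xy i; have lt_i : (enum_rank i < d)%N by exact: leq_trans (ltn_ord _) Id.
have := eq_xy (Ordinal lt_i); rewrite /extend0 /=.
by rewrite valK enum_rankK.
Qed.
End Geometry.

(** * The Frankl-Wilson bound *)

(** In [i * C(p ^ a, i) = p ^ a * C(p ^ a - 1, i - 1)], a binomial prime to [p] would force [p ^ a]
    to divide [i]. *)
Lemma prime_dvd_bin_pow (p a i : nat) :
  prime p -> 0 < i < p ^ a -> p %| 'C(p ^ a, i).
Proof.
move=> p_pr /andP[i_gt0]; apply: contraLR; rewrite -leqNgt.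
rewrite -prime_coprime // => cop; apply: dvdn_leq => //.
rewrite -(Gauss_dvdl _ (coprimeXl a cop)).
by case: i i_gt0 {cop} => // i _; rewrite -mul_bin_diag dvdn_mulr.
Qed.

(* Expand [C(q + j, q - 1)] by Vandermonde: only the term [C(q, 0) C(j, q - 1)]
   survives modulo [p]. *)
Lemma bin_add_pow_mod (p a j : nat) :
  prime p -> 'C(p ^ a + j, (p ^ a).-1) = 'C(j, (p ^ a).-1) %[mod p].
Proof.
move=> p_pr; have q_gt0 : 0 < p ^ a by rewrite expn_gt0 prime_gt0.
rewrite -binomial.Vandermonde big_ord_recl /= bin0 mul1n subn0 -modnDmr.
have /eqP -> : p %| \sum_(i < (p ^ a).-1)
    'C(p ^ a, bump 0 i) * 'C(j, (p ^ a).-1 - bump 0 i); last by rewrite addn0.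
apply: dvdn_sum => i _; apply/dvdn_mulr/prime_dvd_bin_pow => //.
by rewrite /bump /= add1n -[X in _ < X](prednK q_gt0) ltnS.
Qed.

(** With [q = p ^ a], shifting by [q] reduces to [k < q], where only [k = q - 1] counts. The
    binomial thus detects the forbidden intersection size [q - 1] and the full size [2 q - 1]. *)
Lemma bin_pow_pred_mod (p a k : nat) : prime p -> k < 2 * p ^ a ->
  'C(k, (p ^ a).-1) = ((k == (p ^ a).-1) || (k == (2 * p ^ a).-1) : nat) %[mod p].
Proof.
move=> p_pr; have q_gt0 : 0 < p ^ a by rewrite expn_gt0 prime_gt0.
have small j : j < p ^ a -> 'C(j, (p ^ a).-1) = (j == (p ^ a).-1).
  move=> jq; case: eqP => [->|/eqP neq]; first by rewrite binn.
  by rewrite bin_small // -ltnS prednK // ltn_neqAle; lia.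
case: (ltnP k (p ^ a)) => [kq _|/subnKC <-].
  by rewrite small //; congr (nat_of_bool _ %% _); lia.
by move=> lt; rewrite bin_add_pow_mod // small; [congr (nat_of_bool _ %% _)|]; lia.
Qed.

(* Modulo [p], the Gram matrix of the inclusion vectors of the members of the
   family in the [(q - 1)]-subsets is the identity. *)
Lemma frankl_wilson (I : finType) (p a : nat) (F : {set {set I}}) :
  prime p ->
  (forall A, A \in F -> #|A| = (2 * p ^ a).-1) ->
  (forall A B, A \in F -> B \in F -> #|A :&: B| != (p ^ a).-1) ->
  #|F| <= 'C(#|I|, (p ^ a).-1).
Proof.
move=> p_pr cardF interF; set q := p ^ a in cardF interF *.
have q_gt0 : 0 < q by rewrite expn_gt0 prime_gt0.
pose T := [set X : {set I} | #|X| == q.-1].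
rewrite -card_draws -/T.
pose W : 'M['F_p]_(#|F|, #|T|) :=
  (\matrix_(i < #|F|, j < #|T|)
     ((enum_val j : {set I}) \subset (enum_val i : {set I}) : nat)%:R)%R.
have gram : (W *m W^T = 1%:M)%R.
  apply/matrixP => i j; rewrite !mxE.
  set A := enum_val i; set B := enum_val j.
  have AF : A \in F := enum_valP i; have BF : B \in F := enum_valP j.
  transitivity (('C(#|A :&: B|, q.-1))%:R : 'F_p)%R.
    transitivity ((\sum_(X in T) (X \subset A :&: B))%:R : 'F_p)%R.
      rewrite (big_enum_val (fun X : {set I} => X \subset A :&: B : nat)) natr_sum.
      by apply: eq_bigr => k _; rewrite !mxE subsetI -natrM mulnb.
    congr (_%:R)%R; rewrite -cards_draws -sum1_card big_mkcond /= [RHS]big_mkcond /=.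
    by apply: eq_bigr => X _; rewrite !inE andbC; case: (_ \subset _); case: (_ == _).
  rewrite -(Fp_nat_mod p_pr) bin_pow_pred_mod // ?(Fp_nat_mod p_pr); last first.
    have := subset_leq_card (subsetIl A B); rewrite (cardF A) // -/q; lia.
  (* As size [q - 1] is excluded, the entry is 1 exactly when the intersection is full, that is for
     [A = B]. *)
  rewrite -/q (negbTE (interF _ _ AF BF)) /=; congr (_%:R)%R; congr nat_of_bool.
  apply/eqP/eqP => [cardAB|eij]; last by rewrite /A /B eij setIid cardF // -eij.
  apply/enum_val_inj/eqP; rewrite -/A -/B eqEcard !cardF // leqnn andbT.
  by apply/setIidPl/eqP; rewrite eqEcard subsetIl cardAB (cardF A) // leqnn.
have := mxrankM_maxl W (W^T)%R; rewrite gram mxrank1 => /leq_trans; apply.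
exact: rank_leq_col.
Qed.

(** The ratio [C(n, j + 1) / C(n, j) = (n - j) / (j + 1)] is at least [r] as long as
    [(r + 1) * (j + 1) <= n + 1]. *)
Lemma bin_growth (n r k i : nat) :
  r * (k + i) + (k + i) <= n.+1 -> r ^ i * 'C(n, k) <= 'C(n, k + i).
Proof.
elim: i => [|i IHi] hn; first by rewrite mul1n addn0.
rewrite expnS -mulnA; apply: leq_trans (_ : _ <= r * 'C(n, k + i)) _.
  by rewrite leq_mul2l IHi ?orbT; nia.
rewrite addnS -(leq_pmul2l (ltn0Sn (k + i))) mul_bin_left.
rewrite mulnA leq_mul2r; apply/orP; right; nia.
Qed.

(** * The graphs *)

Definition slice (I : finType) (w : nat) : finType := {A : {set I} | #|A| == w}.

Definition slice_rel (I : finType) (w k : nat) : rel (slice I w) :=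
  fun A B => #|val A :&: val B| == k.

Lemma card_slice (I : finType) (w : nat) : #|slice I w| = 'C(#|I|, w).
Proof. by rewrite card_sig -card_draws cardsE. Qed.

Lemma slice_rel_sym (I : finType) (w k : nat) : symmetric (@slice_rel I w k).
Proof. by move=> A B; rewrite /slice_rel setIC. Qed.

Lemma slice_rel_irr (I : finType) (w k : nat) : k < w -> irreflexive (@slice_rel I w k).
Proof. by move=> kw A; rewrite /slice_rel setIid (eqP (valP A)) gtn_eqF. Qed.

Lemma slice_independent_card (I : finType) (p a : nat) (T : {set slice I (2 * p ^ a).-1}) :
  prime p -> independent_in (@slice_rel I (2 * p ^ a).-1 (p ^ a).-1) T ->
  #|T| <= 'C(#|I|, (p ^ a).-1).
Proof.
move=> p_pr /forall_inP indT; rewrite -(card_imset _ val_inj).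
apply: frankl_wilson => // [_ /imsetP[A _ ->]|_ _ /imsetP[A AT ->] /imsetP[B BT ->]].
  exact/eqP/(valP A).
exact: (forall_inP (indT _ AT)).
Qed.

(** Two [(2 q - 1)]-sets meeting in [q - 1] points have a symmetric difference of size [2 q], whence
    the scaling of the indicator vectors. *)
Definition slice_point (R : rcfType) (I : finType) (w q : nat) (A : slice I w) : I -> R :=
  fun i => ((i \in val A)%:R / Num.sqrt (2 * q)%:R)%R.

Lemma slice_point_inj (R : rcfType) (I : finType) (w q : nat) (A B : slice I w) :
  0 < q -> slice_point R q A =1 slice_point R q B -> A = B.
Proof.
move=> q_gt0 eqAB; apply/val_inj/setP => i; move/eqP: (eqAB i).
have sqrt_neq0 : (Num.sqrt (2 * q)%:R)^-1%R != 0%R :> R.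
  by rewrite invr_eq0 gt_eqF // sqrtr_gt0 ltr0n muln_gt0.
rewrite /slice_point (inj_eq (mulIf sqrt_neq0)) eqr_nat.
by case: (_ \in _); case: (_ \in _).
Qed.

Lemma sqdist_slice_point (R : rcfType) (I : finType) (q : nat)
    (A B : slice I (2 * q).-1) :
  0 < q -> slice_rel q.-1 A B -> sqdist (slice_point R q A) (slice_point R q B) = 1%R.
Proof.
move=> q_gt0 /eqP cardAB; rewrite /sqdist /slice_point.
have cardA := eqP (valP A); have cardB := eqP (valP B).
have -> : (\sum_i ((i \in val A)%:R / Num.sqrt (2 * q)%:R
                - (i \in val B)%:R / Num.sqrt (2 * q)%:R) ^+ 2 =
       (\sum_i ((i \in val A)%:R + (i \in val B)%:R
                - 2 * (i \in val A :&: val B)%:R)) / (2 * q)%:R :> R)%R.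
  rewrite mulr_suml; apply: eq_bigr => i _; rewrite -mulrBl exprMn exprVn sqr_sqrtr ?ler0n //.
  congr (_ * _)%R; rewrite inE; case: (_ \in _); case: (_ \in _) => /=; ring.
rewrite sumrB big_split /= -mulr_sumr -!natr_sum.
have sum_card (C : {set I}) : \sum_i (i \in C : nat) = #|C|.
  by rewrite -sum1_card [RHS]big_mkcond /=; apply: eq_bigr => i _; case: (_ \in _).
rewrite !sum_card cardA cardB cardAB -natrD -natrM -natrB; last by lia.
have -> : (2 * q).-1 + (2 * q).-1 - 2 * q.-1 = 2 * q by lia.
by rewrite divff // pnatr_eq0 -lt0n muln_gt0.
Qed.

Lemma chi_gt (G : sgraph) (c : nat) :
  (forall col : vert G -> 'I_c, exists x y, adj x y && (col x == col y)) -> c < chi G.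
Proof.
move=> no_col; rewrite ltnNge; apply/negP; rewrite /chi.
case: ex_minnP => k /existsP[col /forallP proper] _ kc.
have [x [y /andP[exy]]] := no_col (fun x => widen_ord kc (col x)).
have := forallP (proper x) y; rewrite exy /= => /eqP neq /eqP[] /val_inj; exact: neq.
Qed.

(** By [bin_growth], the slice graph has at least [r ^ q] times as many vertices as the
    Frankl-Wilson bound allows in an independent set, so [r ^ q %/ 2] colours do not suffice. The
    ground set has even size because [rotate] pairs coordinates. *)
Lemma high_girth_unit_distance_graph (m a r d g : nat) :
  0 < r -> 2 * m <= d -> r.+1 * (2 * 2 ^ a).-1 <= (2 * m).+1 ->
  exists G : sgraph,
    [/\ unit_distance_graph d G, girth_ge G g & r ^ (2 ^ a) < 2 * chi G].
Proof.
move=> r_gt0 md rm; set q := 2 ^ a in rm *.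
have q_gt0 : 0 < q by rewrite expn_gt0.
pose I : finType := ('I_m * bool)%type.
have cardI : #|I| = 2 * m by rewrite card_prod card_ord card_bool mulnC.
pose U := slice I (2 * q).-1; pose h : rel U := @slice_rel I (2 * q).-1 q.-1.
have h_irr : irreflexive h by apply: slice_rel_irr; lia.
have grow : r ^ q * 'C(2 * m, q.-1) <= #|U|.
  rewrite card_slice cardI; have -> : (2 * q).-1 = q.-1 + q by lia.
  by apply: bin_growth; move: rm; nia.
have al_gt0 : 0 < 'C(2 * m, q.-1).
  rewrite bin_gt0; have := leq_pmull (2 * q).-1 (ltn0Sn r); lia.
have U_gt0 : 0 < #|U|.
  by apply: leq_trans grow; rewrite muln_gt0 al_gt0 expn_gt0 r_gt0.
have indep (A : {set U}) : independent_in h A -> #|A| <= 'C(2 * m, q.-1).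
  by rewrite -cardI; exact: slice_independent_card.
have [|t [e [e_sym eh girth_e no_col]]] := @high_girth_power U h _ (r ^ q %/ 2) g
  (@slice_rel_sym I _ _) h_irr al_gt0 U_gt0 indep.
  apply: leq_trans grow; by rewrite mulnAC leq_mul2r [2 * (_ %/ _)]mulnC leq_divM orbT.
have e_irr : irreflexive e.
  by move=> x; apply/negP => /eh/existsP[j]; rewrite h_irr.
exists (SGraph e_sym e_irr); split => //; last first.
  have : r ^ q %/ 2 < chi (SGraph e_sym e_irr) by exact: chi_gt.
  by rewrite ltn_divLR // mulnC.
pose f : U -> I -> R := @slice_point R I (2 * q).-1 q.
have f_inj u v : f u =1 f v -> u = v by exact: slice_point_inj.
have [z normz z_inj] := exists_injective_placement t f_inj.
have Id : #|I| <= d by rewrite cardI.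
exists (fun x i => extend0 (placement f z x) (nat_of_ord i)); split => [x y eq_xy|x y exy].
  by apply/z_inj/(extend0_inj Id) => i; rewrite (f_equal (fun F => F i) eq_xy).
have unit_xy : sqdist (placement f z x) (placement f z y) = 1%R.
  by apply: sqdist_placement (eh _ _ exy) => // u v; exact: sqdist_slice_point.
rewrite /eucl_dist -[RHS]sqrt_1; congr sqrt; rewrite -[RHS]unit_xy -(sqdist_extend0 _ _ Id).
by apply: eq_bigr => i _; rewrite expr2.
Qed.

(* Numerical estimates and choice of parameters *)
Local Delimit Scope R_scope with coqR.

(** Eight of the factors gain the 2 lost in [r ^ q < 2 * chi G]; the others compare by
    monotonicity. *)
Lemma two_pow_le (b c : R) (q : nat) :
  (0 <= b)%coqR -> (b <= c)%coqR -> (2 * b ^ 8 <= c ^ 8)%coqR -> 8 <= q ->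
  (2 * b ^ q <= c ^ q)%coqR.
Proof.
move=> b_ge0 bc base; move/subnK <-; rewrite !pow_add.
have mono := pow_incr b c (q - 8) (conj b_ge0 bc).
have := Rmult_le_compat _ _ _ _ (pow_le b (q - 8) b_ge0)
  (Rmult_le_pos 2 (b ^ 8) ltac:(Lra.lra) (pow_le b 8 b_ge0)) mono base.
Lra.lra.
Qed.

Lemma pow_1074_le (b c : R) (k d q : nat) :
  (0 <= b)%coqR -> (b <= c)%coqR -> (2 * b ^ 8 <= c ^ 8)%coqR ->
  ((1074 / 1000) ^ k <= b)%coqR -> 8 <= q -> d <= k * q ->
  (2 * (1074 / 1000) ^ d <= c ^ q)%coqR.
Proof.
move=> b_ge0 bc base kb q8 dkq.
apply: Rle_trans (two_pow_le b_ge0 bc base q8).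
apply: Rmult_le_compat_l; first Lra.lra.
apply: Rle_trans (_ : _ <= ((1074 / 1000) ^ (k * q)))%coqR _.
  by apply: Rle_pow; [Lra.lra | exact/ssrnat.leP].
rewrite -multE pow_mult; apply: pow_incr; split=> //; apply: pow_le; Lra.lra.
Qed.

Theorem theorem1p1 :
  exists eps : nat -> R,
    Un_cv eps R0 /\
    forall g d : nat, (3 <= g)%N -> (0 < d)%N ->
      exists G : sgraph,
        unit_distance_graph d G /\ girth_ge G g /\
        Rle (pow (Rplus (Rdiv (IZR 1074) (IZR 1000)) (eps d)) d) (INR (chi G)).
Proof.
(* For [d < 100] the base becomes 0, so a single vertex suffices; from 100 on, [eps] vanishes and
   [q >= 8]. *)
exists (fun d => if d < 100 then Ropp (Rdiv (IZR 1074) (IZR 1000)) else R0); split.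
  move=> e e_gt0; exists 100 => n /ssrnat.leP n100.
  by rewrite ltnNge n100 /= /Rdist Rminus_0_r Rabs_R0.
move=> g d _ d_gt0; case: ltnP => [_|d100].
  exists (@SGraph unit (fun _ _ => false) (fun _ _ => erefl) (fun=> erefl)).
  split; first by exists (fun _ _ => R0); split=> // -[] [].
  split; first by move=> [|x [|y s]].
  by rewrite Rplus_opp_r pow_i; [exact: pos_INR | exact/ssrnat.ltP].
pose m := d./2; pose n := 2 * m.
have n6_gt0 : 0 < n %/ 6 by rewrite /n /m; lia.
pose a := trunc_log 2 (n %/ 6).
have /andP[] : 2 ^ a <= n %/ 6 < 2 ^ a.+1 by exact: trunc_log_bounds.
rewrite expnS; set q := 2 ^ a => q_le q_gt.
have nq6 : 6 * q <= n by lia.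
have nq12 : n < 12 * q by lia.
have [r /andP[r_gt0 rn] bound] : exists2 r, (0 < r) && (r.+1 * (2 * q).-1 <= n.+1)
    & (2 * (1074 / 1000) ^ d <= INR r ^ q)%coqR.
  have q8 : 8 <= q by rewrite /n /m in nq12; have := odd_double_half d; lia.
  have dn : d <= n.+1 by rewrite /n /m; lia.
  (* For [8 * q <= n] take [r = 3], with [d <= 12 * q] and [1.074 ^ 12 <= 5 / 2]; otherwise [r = 2],
     with [d <= 8 * q] and [1.074 ^ 8 <= 9 / 5]. *)
  case: (leqP (8 * q) n) => nq8; [exists 3; first lia | exists 2; first lia].
    apply: (@pow_1074_le (5 / 2) _ 12) => //; rewrite ?/INR /=; try Lra.lra; lia.
  apply: (@pow_1074_le (9 / 5) _ 8) => //; rewrite ?/INR /=; try Lra.lra; lia.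
have [||G [udG girthG chiG]] := @high_girth_unit_distance_graph m a r d g r_gt0.
- by rewrite /m; lia.
- exact: rn.
exists G; split=> //; split=> //; rewrite Rplus_0_r.
have : (INR (r ^ q) <= INR (2 * chi G))%coqR by apply/le_INR/ssrnat.leP/ltnW.
rewrite mult_INR /=.
have -> : INR (r ^ q) = (INR r ^ q)%coqR.
  by elim: (q) => //= k IHk; rewrite expnS mult_INR IHk.
Lra.lra.
Qed.
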